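(* Let $1<\alpha\le 2$, let $\beta$ be a real constant, let $\Omega=(x_L,x_R)$ be a bounded interval with $L=x_R-x_L$, and let $V=V(x)$ be an arbitrary potential function. Consider the pair of real-valued equations $$p_t=(-\Delta)^{\frac{\alpha}{2}}q-Vq-\beta(p^2+q^2)q,\qquad q_t=-(-\Delta)^{\frac{\alpha}{2}}p+Vp+\beta(p^2+q^2)p,$$ for $p=p(x,t)$, $q=q(x,t)$, $x\in\Omega$, $t\in(0,T]$, with the periodic boundary conditions $p(x,t)=p(x+L,t)$, $q(x,t)=q(x+L,t)$. This system is an infinite-dimensional canonical Hamiltonian system $$\begin{pmatrix}p_t\\ q_t\end{pmatrix}=\begin{pmatrix}0&-1\\ 1&0\end{pmatrix}\begin{pmatrix}\delta\mathcal{H}/\delta p\\ \delta\mathcal{H}/\delta q\end{pmatrix},$$ where the energy functional is $$\mathcal{H}=-\frac12\int_\Omega\Big[\big((-\Delta)^{\frac{\alpha}{4}}p\big)^2+\big((-\Delta)^{\frac{\alpha}{4}}q\big)^2-V(p^2+q^2)-\frac{\beta}{2}(p^2+q^2)^2\Big]dx .$$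
   Context: The system is obtained by writing $u=p+\mathrm{i}q$ in the one-dimensional space fractional nonlinear Schrödinger equation $\mathrm{i}u_t-(-\Delta)^{\alpha/2}u+(V+\beta|u|^2)u=0$. The fractional Laplacian on $\Omega$ with periodic boundary conditions is defined by Fourier series: $$(-\Delta)^{\frac{\alpha}{2}}u(x,t)=\sum_{k\in\mathbb{Z}}|\upsilon_k|^{\alpha}\,\hat u_k\,e^{\mathrm{i}\upsilon_k(x-x_L)},\qquad \upsilon_k=\frac{2k\pi}{x_R-x_L},\qquad \hat u_k=\frac{1}{x_R-x_L}\int_\Omega u(x,t)e^{-\mathrm{i}\upsilon_k(x-x_L)}dx ,$$ and $(-\Delta)^{\frac{\alpha}{4}}$ is defined in the same way with $|\upsilon_k|^{\alpha/2}$ in place of $|\upsilon_k|^{\alpha}$. The variational derivative of a functional $G[\psi]=\int_\Omega g\big(\theta,\psi(\theta),(-\Delta)^{\frac{\alpha}{4}}\psi(\theta)\big)d\theta$ is given by $$\frac{\delta G}{\delta\psi}=\frac{\partial g}{\partial\psi}+(-\Delta)^{\frac{\alpha}{4}}\frac{\partial g}{\partial\big((-\Delta)^{\frac{\alpha}{4}}\psi\big)},$$ and $\delta\mathcal{H}/\delta p$, $\delta\mathcal{H}/\delta q$ are the variational derivatives with respect to $p$ and $q$ (the other variable being fixed). *)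

(* Defs.v *)
From mathcomp Require Import all_boot all_order all_algebra.
From mathcomp Require Import complex.
From mathcomp Require Import all_classical all_reals all_analysis.

Set Implicit Arguments.
Unset Strict Implicit.
Unset Printing Implicit Defensive.

Import Order.TTheory GRing.Theory Num.Theory.
Import numFieldNormedType.Exports.

Local Open Scope classical_set_scope.
Local Open Scope ring_scope.
Local Open Scope complex_scope.

Section fractional_laplacian.
Context {R : realType}.
Variables xL xR : R.
Local Notation mu := (@lebesgue_measure R).
Implicit Types (a x : R) (k : int) (N : nat).

Definition dom : set R := `]xL, xR[.

Definition freq k : R := 2 * k%:~R * pi / (xR - xL).

Definition expi (y : R) : R[i] := cos y +i* sin y.

Definition cintegral (f : R -> R[i]) : R[i] :=
  (\int[mu]_(x in dom) complex.Re (f x)) +i* (\int[mu]_(x in dom) complex.Im (f x)).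

Definition fourier_coef (u : R -> R[i]) k : R[i] :=
  ((xR - xL)^-1)%:C * cintegral (fun x => u x * expi (- (freq k * (x - xL)))).

(* The term of index k in the Fourier series of (-Delta)^a u, whose symbol is
   |freq k|^(2a). *)
Definition frac_term a (u : R -> R[i]) x k : R[i] :=
  (`|freq k| `^ (2 * a))%:C * fourier_coef u k * expi (freq k * (x - xL)).

(* The sum over -N <= k <= N. *)
Definition frac_partial a (u : R -> R[i]) x N : R[i]^o :=
  \sum_(j < N.*2.+1) frac_term a u x (j%:Z - N%:Z).

(* (-Delta)^a u, the sum over all integers k being the limit of the symmetric
   partial sums. *)
Definition cfrac_lap a (u : R -> R[i]) x : R[i]^o :=
  lim (frac_partial a u x @ \oo).

(* For real-valued u, (-Delta)^a u is real-valued: see frac_lap_real. *)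
Definition frac_lap a (u : R -> R) x : R :=
  complex.Re (cfrac_lap a (fun y => (u y)%:C) x).

(* The Fourier coefficients of u make sense, and the series defining
   (-Delta)^a u converges at every point of the domain. *)
Definition frac_lap_defined a (u : R -> R) : Prop :=
  mu.-integrable dom (EFin \o u) /\
  forall x, dom x -> cvg (frac_partial a (fun y => (u y)%:C) x @ \oo).

Lemma expiN y : expi (- y) = (expi y)^*.
Proof. by rewrite /expi cosN sinN. Qed.

Lemma freqN k : freq (- k) = - freq k.
Proof. by rewrite /freq rmorphN mulrN !mulNr. Qed.

Lemma RintegralN_total (D : set R) (f : R -> R) :
  \int[mu]_(x in D) (- f x) = - \int[mu]_(x in D) f x.
Proof.
rewrite /Rintegral.
under eq_integral do rewrite EFinN.
rewrite integralE [in RHS]integralE.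
have -> : (fun x => - (f x)%:E)%E = (\- (fun x => (f x)%:E))%E by [].
rewrite funeposN funenegN.
have : (0 <= \int[mu]_(x in D) (fun x => (f x)%:E)^\+ x)%E.
  by apply: integral_ge0 => x _; exact: funepos_ge0.
have : (0 <= \int[mu]_(x in D) (fun x => (f x)%:E)^\- x)%E.
  by apply: integral_ge0 => x _; exact: funeneg_ge0.
case: (\int[mu]_(x in D) _)%E => [r| |] //;
case: (\int[mu]_(x in D) _)%E => [s| |] //= _ _; rewrite ?oppr0 //.
by rewrite opprB.
Qed.

Lemma fourier_coefN (u : R -> R) k :
  fourier_coef (fun y => (u y)%:C) (- k) =
  (fourier_coef (fun y => (u y)%:C) k)^*.
Proof.
rewrite /fourier_coef rmorphM; congr (_ * _); first by rewrite /= oppr0.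
rewrite /cintegral; congr (_ +i* _).
  by apply: eq_Rintegral => x _; rewrite freqN mulNr opprK /= cosN !mul0r.
rewrite -RintegralN_total; apply: eq_Rintegral => x _.
by rewrite freqN mulNr opprK /= sinN !mul0r !addr0 mulrN opprK.
Qed.

Lemma frac_termN a (u : R -> R) x k :
  frac_term a (fun y => (u y)%:C) x (- k) =
  (frac_term a (fun y => (u y)%:C) x k)^*.
Proof.
rewrite /frac_term freqN normrN fourier_coefN mulNr expiN !rmorphM.
by congr (_ * _ * _); rewrite /= oppr0.
Qed.

Lemma frac_partial_real a (u : R -> R) x N :
  complex.Im (frac_partial a (fun y => (u y)%:C) x N) = 0.
Proof.
suff /eqP : (frac_partial a (fun y => (u y)%:C) x N)^* =
    frac_partial a (fun y => (u y)%:C) x N.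
  by case: (frac_partial _ _ _ _) => r s /=; rewrite eq_complex /= eqNr => /andP[_ /eqP].
rewrite /frac_partial rmorph_sum [RHS](reindex_inj rev_ord_inj) /=.
apply: eq_bigr => j _; apply: etrans (esym (frac_termN _ _ _ _)) _.
congr (frac_term _ _ _ _).
rewrite opprB subSS -subzn; last by rewrite -ltnS.
by have -> : N.*2%:Z = N%:Z + N%:Z; [rewrite -addnn PoszD | rewrite addrAC addrK].
Qed.

Lemma frac_lap_real a (u : R -> R) x :
  cvg (frac_partial a (fun y => (u y)%:C) x @ \oo) ->
  cfrac_lap a (fun y => (u y)%:C) x = (frac_lap a u x)%:C.
Proof.
move=> cv; rewrite /frac_lap; move: cv; rewrite /cfrac_lap.
set l := lim _ => /cvgrPdist_lt cv.
apply/eqP; rewrite eq_complex eqxx /=; apply: contraT => l0.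
have e0 : (0 : R[i]) < `|complex.Im l|%:C by rewrite ltcR normr_gt0.
have [N _ /(_ N (leqnn N))] := cv _ e0.
have := frac_partial_real a u x N.
move: l0; case: l {cv e0} => r s; case: (frac_partial _ _ _ _) => r' s' /= s0 ->.
rewrite normc_def /= subr0 ltcR => /lt_geF <-.
by rewrite -sqrtr_sqr ler_wsqrtr// lerDr sqr_ge0.
Qed.

(* The functional psi |-> int g(x, psi(x), (-Delta)^(alpha/4) psi(x)) dx. *)
Definition density_functional alpha (g : R -> R -> R -> R) (psi : R -> R) : R :=
  \int[mu]_(x in dom) g x (psi x) (frac_lap (alpha / 4) psi x).

Definition variational_derivative alpha (g : R -> R -> R -> R) (psi : R -> R) x : R :=
  let w := frac_lap (alpha / 4) psi in
  derive1 (fun a => g x a (w x)) (psi x) +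
  frac_lap (alpha / 4) (fun y => derive1 (g y (psi y)) (w y)) x.

Section energy.
Variables (alpha beta : R) (V : R -> R).

Definition energy (p q : R -> R) : R :=
  - (1 / 2) * \int[mu]_(x in dom)
    (frac_lap (alpha / 4) p x ^+ 2 + frac_lap (alpha / 4) q x ^+ 2
     - V x * (p x ^+ 2 + q x ^+ 2) - beta / 2 * (p x ^+ 2 + q x ^+ 2) ^+ 2).

(* The integrand of the energy at x, as a function of the values of p, q,
   (-Delta)^(alpha/4) p and (-Delta)^(alpha/4) q at x. *)
Definition energy_density x (p q wp wq : R) : R :=
  - (1 / 2) * (wp ^+ 2 + wq ^+ 2
    - V x * (p ^+ 2 + q ^+ 2) - beta / 2 * (p ^+ 2 + q ^+ 2) ^+ 2).

Definition energy_density_p (q : R -> R) x (p wp : R) : R :=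
  energy_density x p (q x) wp (frac_lap (alpha / 4) q x).

Definition energy_density_q (p : R -> R) x (q wq : R) : R :=
  energy_density x (p x) q (frac_lap (alpha / 4) p x) wq.

Definition denergy_dp (p q : R -> R) : R -> R :=
  variational_derivative alpha (energy_density_p q) p.

Definition denergy_dq (p q : R -> R) : R -> R :=
  variational_derivative alpha (energy_density_q p) q.

End energy.

(* f'(t) = d, differentiating along ]0, T] (so from the left at t = T). *)
Definition is_time_derivative (T : R) (f : R -> R) (t d : R) : Prop :=
  (s - t)^-1 * (f s - f t) @[s --> within [set s | 0 < s <= T] t^'] --> d.

Definition canonical_J : 'M[R]_2 := \matrix_(i, j)
  if (i == 0) && (j == 1) then -1 else if (i == 1) && (j == 0) then 1 else 0.

Definition col2 (a b : R) : 'cV[R]_2 := \col_i (if i == 0 then a else b).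

End fractional_laplacian.

(* Main.v *)
(* The only analytic point is that (-Delta)^(alpha/4) applied twice is
   (-Delta)^(alpha/2) pointwise on the domain, although only the pointwise
   convergence of the series of (-Delta)^(alpha/2) p is known. Pairing the indices
   k and -k turns this series into sum_k T_k with T_k = A_k cos + B_k sin. By
   the Cantor-Lebesgue argument the amplitudes of T_k are bounded, so those of the
   terms l_k T_k of the series of w = (-Delta)^(alpha/4) p, where
   l_k = |freq k|^(-alpha/2), are square summable because alpha > 1. That series
   converges pointwise by Abel's test; by Fatou's lemma and orthogonality its
   partial sums converge to w in L^2, so that w has the expected Fourier
   coefficients. *)
Require Import Defs.
From mathcomp Require Import all_boot all_order all_algebra.
From mathcomp Require Import complex.
From mathcomp Require Import all_classical all_reals all_analysis.
From mathcomp Require Import measurable_realfun ring lra.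

Set Implicit Arguments.
Unset Strict Implicit.
Unset Printing Implicit Defensive.

Import Order.TTheory GRing.Theory Num.Theory.
Import numFieldNormedType.Exports.

Local Open Scope classical_set_scope.
Local Open Scope ring_scope.

Section series_tests.
Context {R : realType}.
Implicit Types (u l : R ^nat) (e : R).

Lemma abel_inequality u l e m n :
  (forall k, 0 <= l k) -> nonincreasing_seq l ->
  (forall j, `|\sum_(m <= k < j) u k| <= e) ->
  `|\sum_(m <= k < n) l k * u k| <= e * l m.
Proof.
move=> l0 dl ue; have [nm|/ltnW/subnKC <-] := leqP n m.
  by rewrite big_geq// normr0 mulr_ge0// (le_trans _ (ue m)).
have summation_by_parts d : `|\sum_(m <= k < m + d) l k * u k
    - l (m + d)%N * \sum_(m <= k < m + d) u k| <= e * (l m - l (m + d)%N).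
  elim: d => [|d IH]; first by rewrite addn0 !big_geq// subrr !mulr0 subrr normr0.
  rewrite addnS; set U' := \sum_(m <= k < (m + d).+1) u k.
  have -> : \sum_(m <= k < (m + d).+1) l k * u k - l (m + d).+1 * U' =
      (\sum_(m <= k < m + d) l k * u k
        - l (m + d)%N * \sum_(m <= k < m + d) u k) +
      (l (m + d)%N - l (m + d).+1) * U'.
    by rewrite /U' !big_nat_recr ?leq_addr//=; ring.
  have ll : 0 <= l (m + d)%N - l (m + d).+1 by rewrite subr_ge0 dl.
  have -> : e * (l m - l (m + d).+1) =
      e * (l m - l (m + d)%N) + (l (m + d)%N - l (m + d).+1) * e by ring.
  rewrite (le_trans (ler_normD _ _))// lerD// normrM ger0_norm//.
  by rewrite ler_wpM2l // ue.
set d := (n - m)%N.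
rewrite -[X in `|X|](subrK (l (m + d)%N * \sum_(m <= k < m + d) u k)).
rewrite (le_trans (ler_normD _ _))// normrM (ger0_norm (l0 _)).
have -> : e * l m = e * (l m - l (m + d)%N) + l (m + d)%N * e by ring.
by rewrite lerD// ler_wpM2l.
Qed.

Lemma abel_test u l : (forall k, 0 <= l k) -> nonincreasing_seq l ->
  cvgn (series u) -> cvgn (series (fun k => l k * u k)).
Proof.
move=> l0 dl /cvg_cauchy/cauchy_seriesP cu; apply: cauchy_cvg.
apply/cauchy_seriesP => e e0; have d0 : 0 < e / (2 * (l 0%N + 1)).
  by rewrite divr_gt0// mulr_gt0// ltr_wpDl.
have [[A B]/= [[N1 _ AN] [N2 _ BN]] AB] := cu _ d0.
exists ([set n | (maxn N1 N2 <= n)%N], setT) => /=.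
  by split; [exists (maxn N1 N2)|exact: filterT].
move=> [m n]/= [mN _]; have ue j : `|\sum_(m <= k < j) u k| <= e / (2 * (l 0%N + 1)).
  have [jm|mj] := leqP j m; first by rewrite big_geq// normr0 ltW.
  apply/ltW/(AB (m, j)); split => /=.
    by apply: AN; apply: leq_trans mN; exact: leq_maxl.
  by apply: BN; apply: leq_trans (ltnW mj); apply: leq_trans mN; exact: leq_maxr.
rewrite (le_lt_trans (abel_inequality _ l0 dl ue))//.
rewrite mulrAC ltr_pdivrMr ?mulr_gt0 ?ltr_wpDl// ltr_pM2l//.
have := dl _ _ (leq0n m); have := l0 0%N; have := l0 m; lra.
Qed.

Lemma is_cvg_riemannR (a : R) : 1 < a -> cvgn (series (riemannR a)).
Proof.
move=> a1; set s := a - 1; have s0 : 0 < s by rewrite subr_gt0.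
pose v (n : nat) : R := n.+1%:R `^ (- s).
have v0 n : 0 < v n by rewrite powR_gt0.
have step n : s * riemannR a n.+1 <= v n - v n.+1.
  have n1 : 0 < n.+2%:R :> R by [].
  have -> : riemannR a n.+1 = v n.+1 / n.+2%:R.
    rewrite /riemannR /v -[X in _ / X]powRr1// -!powRN -powRD.
      by congr (_ `^ _); rewrite /s; ring.
    by rewrite pnatr_eq0 implybT.
  have -> : v n = v n.+1 * expR (- s * ln (n.+1%:R / n.+2%:R)).
    rewrite /v /powR !pnatr_eq0 /= -expRD; congr expR.
    by rewrite ln_div ?posrE//; ring.
  have : ln (n.+1%:R / n.+2%:R) <= - n.+2%:R^-1 :> R.
    have -> : n.+1%:R / n.+2%:R = 1 + (- n.+2%:R^-1) :> R.
      apply: (mulIf (lt0r_neq0 n1)); rewrite mulrDl mulNr mulVf ?divfK ?lt0r_neq0//.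
      by rewrite mul1r -[n.+2%:R]natr1 addrK.
    apply: le_ln1Dx; rewrite ltrN2 invf_lt1//.
    by rewrite ltr1n.
  rewrite -(ler_pM2l s0) -(ler_pM2l (v0 n.+1)) => h.
  have := expR_ge1Dx (- s * ln (n.+1%:R / n.+2%:R)).
  rewrite -(ler_pM2l (v0 n.+1)); move: h.
  set E := expR _; set l := ln _; move: E l (n.+2%:R^-1) (v n.+1) => E l i w; nra.
have bound n : s * series (riemannR a) n.+1 <= s + v 0%N - v n.
  elim: n => [|n IH].
    rewrite seriesSr seriesEord/= big_ord0 add0r.
    have -> : riemannR a 0%N = 1 by rewrite /riemannR powR1 invr1.
    lra.
  by rewrite seriesSr mulrDr; have := step n; lra.
have pos n : 0 <= riemannR a n by apply/ltW/riemannR_gt0/ltW/(lt_trans _ a1).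
apply: nondecreasing_is_cvgn.
  by apply: (@nondecreasing_series R (riemannR a) xpredT 0%N) => n _ _.
exists ((s + v 0%N) / s) => _ [n _ <-]; rewrite ler_pdivlMr// mulrC.
apply: (@le_trans _ _ (s * series (riemannR a) n.+1)).
  by rewrite ler_pM2l// seriesSr lerDl.
by rewrite (le_trans (bound n))// gerBl ltW.
Qed.

End series_tests.

Section L2_series.
Context d {T : measurableType d} {R : realType}.
Variables (mu : {measure set T -> \bar R}) (D : set T).
Hypotheses (mD : measurable D) (muD : (mu D < +oo)%E).
Implicit Types (f : nat -> T -> R) (w g : T -> R) (r : R ^nat).

Definition bounded_measurable g :=
  measurable_fun D g /\ exists K, forall x, D x -> `|g x| <= K.

Lemma bounded_measurable_integrable g :
  bounded_measurable g -> mu.-integrable D (EFin \o g).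
Proof.
move=> [mg [K gK]]; apply: measurable_bounded_integrable => //.
exists K; split; first exact: num_real.
by move=> M KM x Dx /=; rewrite (le_trans (gK _ Dx))// ltW.
Qed.

Lemma bounded_measurableM g h : bounded_measurable g -> bounded_measurable h ->
  bounded_measurable (fun x => g x * h x).
Proof.
move=> [mg [K gK]] [mh [K' hK]]; split; first exact: measurable_funM.
by exists (K * K') => x Dx; rewrite normrM ler_pM ?gK ?hK.
Qed.

Lemma bounded_measurableD g h : bounded_measurable g -> bounded_measurable h ->
  bounded_measurable (fun x => g x + h x).
Proof.
move=> [mg [K gK]] [mh [K' hK]]; split; first exact: measurable_funD.
by exists (K + K') => x Dx; rewrite (le_trans (ler_normD _ _))// lerD ?gK ?hK.
Qed.

Lemma bounded_measurable_cst k : bounded_measurable (fun=> k).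
Proof. by split; [exact: measurable_cst|exists `|k|]. Qed.

Lemma bounded_measurable_sum f (s : seq nat) : (forall k, bounded_measurable (f k)) ->
  bounded_measurable (fun x => \sum_(k <- s) f k x).
Proof.
move=> bf; elim: s => [|k s IH].
  by under eq_fun do rewrite big_nil; exact: bounded_measurable_cst.
by under eq_fun do rewrite big_cons; exact: bounded_measurableD.
Qed.

Lemma Rintegral_sum f (s : seq nat) : (forall k, bounded_measurable (f k)) ->
  \int[mu]_(x in D) (\sum_(k <- s) f k x) = \sum_(k <- s) \int[mu]_(x in D) f k x.
Proof.
move=> bf; elim: s => [|k s IH].
  rewrite big_nil; under eq_Rintegral do rewrite big_nil.
  by rewrite Rintegral_cst// mul0r.
rewrite big_cons; under eq_Rintegral do rewrite big_cons.
rewrite RintegralD ?IH//; apply: bounded_measurable_integrable => //.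
exact: bounded_measurable_sum.
Qed.

Section orthogonal.
Variables (f : nat -> T -> R) (r : R ^nat).
Hypotheses (bf : forall k, bounded_measurable (f k))
  (ortho : forall j k, \int[mu]_(x in D) (f j x * f k x) = (j == k)%:R * r k).

Lemma orthogonal_sum_sqr m n :
  \int[mu]_(x in D) ((\sum_(m <= k < n) f k x) ^+ 2) = \sum_(m <= k < n) r k.
Proof.
under eq_Rintegral do rewrite expr2 big_distrlr /=.
rewrite (Rintegral_sum (f := fun i x => \sum_(m <= j < n) f i x * f j x)); last first.
  move=> k; apply: (bounded_measurable_sum (f := fun j x => f k x * f j x)) => j.
  exact: bounded_measurableM.
apply: eq_big_seq => i; rewrite mem_index_iota => min.
rewrite (Rintegral_sum (f := fun j x => f i x * f j x)); last first.
  by move=> j; exact: bounded_measurableM.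
under eq_bigr do rewrite ortho.
rewrite (bigD1_seq i) ?iota_uniq ?mem_index_iota//= eqxx mul1r big1 ?addr0// => j.
by rewrite eq_sym => /negbTE ->; rewrite mul0r.
Qed.

Lemma orthogonal_norm_ge0 k : 0 <= r k.
Proof.
rewrite -[r k]mul1r -[1]/((true)%:R) -(eqxx k) -ortho.
by apply: Rintegral_ge0 => x _; rewrite -expr2 sqr_ge0.
Qed.

(* Dividing f_k^2 by max(1, r_k) makes the sequence dominated, hence
   r_k / max(1, r_k) tends to 0. *)
Lemma cantor_lebesgue C :
  (forall k x, D x -> f k x ^+ 2 <= C * r k) ->
  (forall x, D x -> f ^~ x @ \oo --> 0) -> exists M, forall k, r k <= M.
Proof.
move=> fC f0; pose m k := Num.max 1 (r k).
have m0 k : 0 < m k by rewrite lt_max ltr01.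
have mV k : (m k)^-1 <= 1 by rewrite invf_le1// le_max lexx.
pose g k x := f k x ^+ 2 / m k.
have bg k : bounded_measurable (g k).
  apply: bounded_measurableM; first exact: bounded_measurableM.
  exact: bounded_measurable_cst.
have g0 k x : 0 <= g k x by rewrite divr_ge0 ?sqr_ge0 ?ltW.
have intg k : (\int[mu]_(x in D) (g k x)%:E = (r k / m k)%:E)%E.
  rewrite -[LHS]fineK; last exact/integrable_fin_num/bounded_measurable_integrable.
  congr EFin; transitivity (\int[mu]_(x in D) g k x) => //.
  rewrite RintegralZr//; last first.
    by apply: bounded_measurable_integrable; exact: bounded_measurableM.
  by have := ortho k k; rewrite eqxx mul1r => ->.
have := @dominated_convergence _ _ _ mu D mD (fun k x => (g k x)%:E) (cst 0%E)
  (fun=> (`|C|)%:E).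
case.
- by move=> k; apply/measurable_EFinP; case: (bg k).
- exact: measurable_cst.
- apply: aeW => x Dx; apply: cvg_EFin; first exact: nearW.
  apply/cvgrPdist_le => e e0.
  have /cvgrPdist_le/(_ _ e0) : f ^~ x \* f ^~ x @ \oo --> (0 * 0 : R).
    by apply: cvgM; exact: f0.
  rewrite mulr0; apply: filterS => k; rewrite /= !sub0r !normrN => fe.
  rewrite /g normrM normfV (gtr0_norm (m0 k)) expr2 (le_trans _ fe)//.
  by rewrite ler_piMr.
- by apply: bounded_measurable_integrable; exact: bounded_measurable_cst.
- apply: aeW => x k Dx; rewrite lee_fin ger0_norm// /g ler_pdivrMr//.
  rewrite (le_trans (fC k x Dx))// (le_trans (ler_norm _))// normrM ler_wpM2l//.
  by rewrite ger0_norm ?orthogonal_norm_ge0// le_max lexx orbT.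
move=> _ _; rewrite integral0; under eq_fun do rewrite intg.
move=> /fine_cvgP[_] /cvgrPdist_lt/(_ 1 ltr01) [N _ rN].
exists (1 + \sum_(k < N) r k) => k; have [kN|Nk] := ltnP k N.
  rewrite (bigD1 (Ordinal kN))//= addrCA lerDl addr_ge0// sumr_ge0// => i _.
  exact: orthogonal_norm_ge0.
have := rN k Nk; rewrite /= sub0r normrN ger0_norm; last first.
  by rewrite divr_ge0 ?orthogonal_norm_ge0 ?ltW.
rewrite ltr_pdivrMr// mul1r lt_max ltxx orbF => /ltW r1.
rewrite (le_trans r1)// lerDl sumr_ge0// => i _; exact: orthogonal_norm_ge0.
Qed.

End orthogonal.
End L2_series.

Section L2_termwise.
Context d {T : measurableType d} {R : realType}.
Variables (mu : {measure set T -> \bar R}) (D : set T).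
Hypotheses (mD : measurable D) (muD : (mu D < +oo)%E).
Variables (f : nat -> T -> R) (r : R ^nat) (w : T -> R).
Hypotheses (bf : forall k, bounded_measurable D (f k))
  (ortho : forall j k, \int[mu]_(x in D) (f j x * f k x) = (j == k)%:R * r k)
  (cr : cvgn (series r)) (fw : forall x, D x -> series (f ^~ x) @ \oo --> w x).

Let S n x := series (f ^~ x) n.
Let h n x := w x - S n x.
Let tail n := limn (series r) - series r n.

Let bS n : bounded_measurable D (S n).
Proof. by apply: bounded_measurable_sum. Qed.

Let mw : measurable_fun D w.
Proof. by apply: (measurable_fun_cvg (h := S)) => // n; case: (bS n). Qed.

Let mh n : measurable_fun D (h n).
Proof. by apply: measurable_funB => //; case: (bS n). Qed.

Let integral_h_sqr n : (\int[mu]_(x in D) (h n x ^+ 2)%:E <= (tail n)%:E)%E.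
Proof.
pose F M x := ((\sum_(n <= k < M + n) f k x) ^+ 2)%:E.
have bF M : bounded_measurable D (fun x => \sum_(n <= k < M + n) f k x).
  exact: bounded_measurable_sum.
have mF M : measurable_fun D (F M).
  by apply/measurable_EFinP/measurable_funX; case: (bF M).
have F0 M x : D x -> (0 <= F M x)%E by rewrite lee_fin sqr_ge0.
have := fatou mu mD mF F0.
have -> : (\int[mu]_(x in D) limn_einf (F ^~ x) =
    \int[mu]_(x in D) (h n x ^+ 2)%:E)%E.
  apply: eq_integral => x /set_mem Dx; apply/(cvg_limn_einf_sup _).1.
  apply: cvg_EFin; first exact: nearW.
  under eq_fun do rewrite /F /= -sub_series_geq ?leq_addl//.
  under eq_fun do rewrite expr2.
  rewrite expr2.
  have cS : (series (f ^~ x) (M + n)%N - series (f ^~ x) n) @[M --> \oo] --> h n x.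
    apply: cvgB; last exact: cvg_cst.
    by rewrite (cvg_shiftn n (series (f ^~ x))); exact: fw.
  exact: cvgM.
rewrite [X in (_ <= X)%E -> _](_ : _ = (tail n)%:E)//.
apply/(cvg_limn_einf_sup _).1.
have -> : (fun M => \int[mu]_(x in D) F M x)%E =
    (fun M => (series r (M + n)%N - series r n)%:E).
  apply/funext => M; rewrite -[LHS]fineK; last first.
    apply/integrable_fin_num => //.
    by apply: bounded_measurable_integrable => //; exact: bounded_measurableM.
  congr EFin; rewrite sub_series_geq ?leq_addl//.
  exact: (orthogonal_sum_sqr mD muD bf ortho).
apply: cvg_EFin; first exact: nearW.
apply: cvgB; last exact: cvg_cst.
by rewrite (cvg_shiftn n (series r)).
Qed.

Let ih2 n : mu.-integrable D (EFin \o (fun x => h n x ^+ 2)).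
Proof.
apply/integrableP; split; first by apply/measurable_EFinP/measurable_funX.
under eq_integral do rewrite /= ger0_norm ?sqr_ge0//.
by rewrite (le_lt_trans (integral_h_sqr n))// ltry.
Qed.

Let ibound n e : mu.-integrable D (EFin \o (fun x => e + e^-1 * h n x ^+ 2)).
Proof.
have -> : EFin \o (fun x => e + e^-1 * h n x ^+ 2) =
    (EFin \o cst e \+ (fun x => e^-1%:E * (EFin \o (fun x => h n x ^+ 2)%R) x))%E.
  by apply/funext => x /=; rewrite EFinD EFinM.
apply: integrableD => //; last exact: integrableZl.
by apply: bounded_measurable_integrable => //; exact: bounded_measurable_cst.
Qed.

Let bound n e x : 0 < e -> `|h n x| <= e + e^-1 * h n x ^+ 2.
Proof.
move=> e0; rewrite -real_normK ?num_real//; set y := `|_|.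
have y0 : 0 <= y by exact: normr_ge0.
rewrite -(ler_pM2l e0) mulrDr mulrA divff ?lt0r_neq0// mul1r.
have := sqr_ge0 (y - e); nra.
Qed.

Lemma L2_series_integrable : mu.-integrable D (EFin \o w).
Proof.
apply: (@le_integrable _ _ _ _ _ mD _ (EFin \o (fun x => 1 + 1^-1 * h 0 x ^+ 2))).
- exact/measurable_EFinP.
- move=> x Dx /=; have <- : h 0 x = w x.
    by rewrite /h /S seriesEord/= big_ord0 subr0.
  by rewrite lee_fin (le_trans _ (ler_norm _))// bound.
- exact: ibound.
Qed.

Lemma L2_series_termwise g : bounded_measurable D g ->
  series (fun k => \int[mu]_(x in D) (f k x * g x)) @ \oo -->
  \int[mu]_(x in D) (w x * g x).
Proof.
move=> bg; have [mg [K gK]] := bg.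
have tail0 : tail @ \oo --> 0.
  by rewrite -(subrr (limn (series r))); apply: cvgB => //; exact: cvg_cst.
have iwg : mu.-integrable D (EFin \o (fun x => w x * g x)).
  apply: (@le_integrable _ _ _ _ _ mD _
      (fun x => (`|K|)%:E * (EFin \o w) x)%E).
  - by apply/measurable_EFinP; exact: measurable_funM.
  - move=> x Dx; rewrite lee_fin !normrM mulrC ler_wpM2r// normr_id.
    by rewrite (le_trans (gK _ Dx))// ler_norm.
  - by apply: integrableZl => //; exact: L2_series_integrable.
have SE n : series (fun k => \int[mu]_(x in D) (f k x * g x)) n =
    \int[mu]_(x in D) (S n x * g x).
  rewrite /S /series /=; under [RHS]eq_Rintegral do rewrite mulr_suml.
  rewrite (@Rintegral_sum _ _ _ mu D mD muD (fun k x => f k x * g x))//.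
  by move=> k; exact: bounded_measurableM.
have est n e : 0 < e -> `|\int[mu]_(x in D) (w x * g x)
    - series (fun k => \int[mu]_(x in D) (f k x * g x)) n|
    <= `|K| * (e * fine (mu D) + e^-1 * tail n).
  move=> e0; rewrite SE -RintegralB//; last first.
    by apply: bounded_measurable_integrable => //; exact: bounded_measurableM.
  have ihg : mu.-integrable D (EFin \o (fun x => w x * g x - S n x * g x)).
    rewrite [X in mu.-integrable D X](_ : _ =
      ((EFin \o (fun x => (w x * g x)%R)) \- (EFin \o (fun x => (S n x * g x)%R)))%E)//.
    apply: integrableB => //; apply: bounded_measurable_integrable => //.
    exact: bounded_measurableM.
  rewrite (le_trans (le_normr_Rintegral mD ihg))//.
  apply: (@le_trans _ _ (\int[mu]_(x in D) (`|K| * (e + e^-1 * h n x ^+ 2)))).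
    apply: le_Rintegral => //.
    - exact: integrable_norm.
    - rewrite [X in mu.-integrable D X](_ : _ =
        (fun x => `|K|%:E * (EFin \o (fun x => e + e^-1 * h n x ^+ 2)%R) x)%E).
        by apply: integrableZl.
      by apply/funext => x; rewrite /= EFinM.
    - move=> x Dx; rewrite -mulrBl normrM mulrC ler_pM// ?bound//.
      by rewrite (le_trans (gK _ Dx))// ler_norm.
  rewrite RintegralZl// ler_wpM2l// RintegralD//; last 2 first.
  - by apply: bounded_measurable_integrable => //; exact: bounded_measurable_cst.
  - rewrite [X in mu.-integrable D X](_ : _ =
      (fun x => e^-1%:E * (EFin \o (fun x => h n x ^+ 2)%R) x)%E).
      by apply: integrableZl.
    by apply/funext => x; rewrite /= EFinM.
  rewrite Rintegral_cst// lerD2l RintegralZl// ler_pM2l ?invr_gt0//.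
  rewrite -lee_fin /Rintegral fineK ?integral_h_sqr//.
  exact: (integrable_fin_num mD (ih2 n)).
have m0 : 0 <= fine (mu D) by exact: fine_ge0.
apply/cvgrPdist_lt => e e0.
pose K' := `|K| + 1; have K'0 : 0 < K' by rewrite ltr_wpDl.
pose m' := fine (mu D) + 1; have m'0 : 0 < m' by rewrite ltr_wpDl.
pose e' := e / (2 * K' * m'); have e'0 : 0 < e' by rewrite divr_gt0// !mulr_gt0.
have t0 : 0 < e' * (e / (2 * K')) by rewrite mulr_gt0// divr_gt0// mulr_gt0.
move/cvgrPdist_lt : tail0 => /(_ _ t0); apply: filterS => n.
rewrite sub0r normrN => tn; rewrite (le_lt_trans (est n e' e'0))//.
have t' : e'^-1 * tail n < e / (2 * K').
  rewrite mulrC ltr_pdivrMr// [ltRHS]mulrC.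
  by apply: le_lt_trans tn; exact: ler_norm.
have e1 : e' * fine (mu D) <= e / (2 * K').
  rewrite /e' invfM mulrA -mulrA ler_piMr//.
    by rewrite ltW// divr_gt0// mulr_gt0.
  by rewrite mulrC ler_pdivrMr// mul1r lerDl.
have : K' * (e' * fine (mu D) + e'^-1 * tail n) < e.
  have -> : e = K' * (e / (2 * K') + e / (2 * K')).
    by field; rewrite lt0r_neq0.
  by rewrite ltr_pM2l// ler_ltD.
have tail_ge0 : 0 <= tail n.
  by rewrite -lee_fin (le_trans _ (integral_h_sqr n))// integral_ge0// => x _;
    rewrite lee_fin sqr_ge0.
apply: le_lt_trans; rewrite ler_wpM2r ?lerDl//.
by rewrite addr_ge0// mulr_ge0// ?invr_ge0 ltW.
Qed.

End L2_termwise.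

Section Rintegral_scaling.
Context d {T : measurableType d} {R : realType}.
Variable mu : {measure set T -> \bar R}.
Implicit Types (D : set T).
Import HBNNSimple.

(* No measurability is assumed: integrals of nonnegative functions are suprema
   over simple functions. *)
Lemma ge0_integralZl_total D (f : T -> \bar R) (k : R) : 0 < k ->
  (forall x, D x -> (0 <= f x)%E) ->
  (\int[mu]_(x in D) (k%:E * f x) = k%:E * \int[mu]_(x in D) f x)%E.
Proof.
have le (g : T -> \bar R) (c : R) : 0 < c -> (forall x, D x -> (0 <= g x)%E) ->
    (c%:E * \int[mu]_(x in D) g x <= \int[mu]_(x in D) (c%:E * g x))%E.
  move=> c0 g0; rewrite -lee_pdivlMl// !ge0_integralE//; last first.
    by move=> x Dx; rewrite mule_ge0 ?g0// lee_fin ltW.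
  apply: ge_ereal_sup => _ [h hg <-]; rewrite lee_pdivlMl//.
  have -> : (c%:E * sintegral mu h =
      sintegral mu (scale_nnsfun h (ltW c0)))%E by rewrite -sintegralrM.
  apply: ereal_sup_ubound; exists (scale_nnsfun h (ltW c0)) => // x /=.
  rewrite erestrict_scale EFinM lee_pmul ?lee_fin ?(ltW c0) ?fun_ge0 ?hg//.
move=> k0 f0; apply/eqP; rewrite eq_le le// andbT.
have kf0 x : D x -> (0 <= k%:E * f x)%E.
  by move=> Dx; rewrite mule_ge0 ?f0// lee_fin ltW.
have ki : 0 < k^-1 by rewrite invr_gt0.
have := le _ _ ki kf0.
rewrite -lee_pdivlMl// invrK => /le_trans; apply.
by under eq_integral do rewrite muleA -EFinM mulVf ?gt_eqF// mul1e.
Qed.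

Lemma RintegralZl_total D (f : T -> R) (k : R) : 0 < k ->
  \int[mu]_(x in D) (k * f x) = k * \int[mu]_(x in D) f x.
Proof.
move=> k0; rewrite /Rintegral.
under eq_integral do rewrite EFinM.
rewrite integralE [in RHS]integralE.
rewrite [X in (X - _)%E](_ : _ = k%:E * \int[mu]_(x in D) (EFin \o f)^\+ x)%E; last first.
  rewrite -ge0_integralZl_total//.
  apply: eq_integral => x _; have := @ge0_funeposM _ _ k (EFin \o f) (ltW k0).
  by move/(congr1 (fun h => h x)) => /= <-.
rewrite [X in (_ - X)%E](_ : _ = k%:E * \int[mu]_(x in D) (EFin \o f)^\- x)%E; last first.
  rewrite -ge0_integralZl_total//.
  apply: eq_integral => x _; have := @ge0_funenegM _ _ k (EFin \o f) (ltW k0).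
  by move/(congr1 (fun h => h x)) => /= <-.
rewrite -[fun x => (f x)%:E]/(EFin \o f).
have : (0 <= \int[mu]_(x in D) (EFin \o f)^\+ x)%E by exact: integral_ge0.
have : (0 <= \int[mu]_(x in D) (EFin \o f)^\- x)%E by exact: integral_ge0.
case: (\int[mu]_(x in D) _)%E => [a| |] //;
case: (\int[mu]_(x in D) _)%E => [b| |] // _ _.
- by rewrite -!EFinM -!EFinB /= mulrBr.
- by rewrite gt0_muley ?lte_fin// mulr0.
- by rewrite gt0_muley ?lte_fin// mulr0.
- by rewrite gt0_muley ?lte_fin// mulr0.
Qed.

End Rintegral_scaling.

Section trigonometric_integrals.
Context {R : realType}.
Variables xL xR : R.
Hypothesis hx : xL < xR.
Local Notation mu := (@lebesgue_measure R).
Local Notation D := (dom xL xR).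
Local Notation L := (xR - xL).
Implicit Types (A B w x : R) (m : int).

Definition harm A B w x : R := A * cos (w * (x - xL)) + B * sin (w * (x - xL)).

Lemma is_derive_harm A B w x :
  is_derive x 1 (harm A B w) (harm (w * B) (- (w * A)) w x).
Proof.
pose g (y : R) := w * (y - xL); have dg : is_derive x 1 g w.
  have -> : g = w \*: (id - cst xL) by apply/funext => y.
  by apply: is_derive_eq; rewrite subr0 /GRing.scale/= mulr1.
have dc : is_derive x 1 (cos \o g) (- sin (g x) * w) by exact: is_derive1_comp.
have ds : is_derive x 1 (sin \o g) (cos (g x) * w) by exact: is_derive1_comp.
have -> : harm A B w = A \*: (cos \o g) + B \*: (sin \o g).
  by apply/funext => y.
by apply: is_derive_eq; rewrite /harm /GRing.scale/=; ring.
Qed.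

Lemma continuous_harm A B w : continuous (harm A B w).
Proof.
move=> x; apply/differentiable_continuous/derivable1_diffP.
by have [] := is_derive_harm A B w x.
Qed.

Lemma measurable_dom : measurable D.
Proof. exact: measurable_itv. Qed.

Lemma lebesgue_dom : mu D = L%:E.
Proof. by rewrite /dom lebesgue_measure_itv/= lte_fin hx. Qed.

Lemma lebesgue_dom_lty : (mu D < +oo)%E.
Proof. by rewrite lebesgue_dom ltry. Qed.

Lemma bounded_measurable_harm A B w : bounded_measurable D (harm A B w).
Proof.
split.
  apply: measurable_funTS; apply: continuous_measurable_fun.
  exact: continuous_harm.
exists (`|A| + `|B|) => x _; rewrite (le_trans (ler_normD _ _))// !normrM.
by rewrite lerD// ler_piMr// (cos_max, sin_max).
Qed.

Lemma integrable_harm A B w : mu.-integrable D (EFin \o harm A B w).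
Proof.
apply: bounded_measurable_integrable; [exact: measurable_dom|exact: lebesgue_dom_lty|].
exact: bounded_measurable_harm.
Qed.

Lemma freq_dom m : freq xL xR m * L = pi *+ 2 * m%:~R.
Proof.
rewrite /freq divfK; last by rewrite subr_eq0 gt_eqF.
by rewrite -mulr_natl; ring.
Qed.

Lemma sin_2pi m : sin (pi *+ 2 * m%:~R : R) = 0.
Proof.
suff h (n : nat) : sin (pi *+ 2 * n%:R : R) = 0.
  case: m => n; first exact: h.
  by rewrite NegzE mulrNz mulrN sinN h oppr0.
by rewrite mulr_natr -[_ *+ n]add0r (periodicn (@sinD2pi R)) sin0.
Qed.

Lemma cos_2pi m : cos (pi *+ 2 * m%:~R : R) = 1.
Proof.
suff h (n : nat) : cos (pi *+ 2 * n%:R : R) = 1.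
  case: m => n; first exact: h.
  by rewrite NegzE mulrNz mulrN cosN h.
by rewrite mulr_natr -[_ *+ n]add0r (periodicn (@cosD2pi R)) cos0.
Qed.

Lemma freq_eq0 m : (freq xL xR m == 0) = (m == 0).
Proof.
rewrite /freq !mulf_eq0 invr_eq0 subr_eq0 (gt_eqF hx) orbF pnatr_eq0 /=.
by rewrite intr_eq0 (gt_eqF (pi_gt0 R)) orbF.
Qed.

Lemma integral_harm A B m :
  \int[mu]_(x in D) harm A B (freq xL xR m) x = (m == 0)%:R * (A * L).
Proof.
have [->|m0] := eqVneq m 0.
  under eq_Rintegral do rewrite /harm /freq mulr0z mulr0 !mul0r cos0 sin0
    mulr1 mulr0 addr0.
  rewrite Rintegral_cst; last exact: measurable_dom.
  by rewrite mul1r; congr (_ * _); exact: (congr1 fine lebesgue_dom).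
set w := freq xL xR m; have w0 : w != 0 by rewrite freq_eq0.
rewrite mul0r /Rintegral -(@integral_itv_bndoo _ _ _ _ true false); last first.
  by apply/measurable_EFinP; case: (bounded_measurable_harm A B w).
pose F := harm (- (B / w)) (A / w) w.
have dF x : is_derive x 1 F (harm A B w x).
  have -> : harm A B w x = harm (w * (A / w)) (- (w * - (B / w))) w x.
    by congr (harm _ _ _ _); field.
  exact: is_derive_harm.
rewrite (@continuous_FTC2 _ _ F)//.
- rewrite /F /harm !subrr mulr0 sin0 cos0 freq_dom sin_2pi cos_2pi.
  by rewrite -EFinB/= subrr.
- exact/continuous_subspaceT/continuous_harm.
- split; first by move=> x _; have [] := dF x.
  + by apply: cvg_at_right_filter; exact: continuous_harm.
  + by apply: cvg_at_left_filter; exact: continuous_harm.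
- by move=> x _; rewrite derive1E; have [] := dF x.
Qed.

Lemma freqD m m' : freq xL xR (m + m') = freq xL xR m + freq xL xR m'.
Proof. by rewrite /freq rmorphD/=; ring. Qed.

Lemma freqB m m' : freq xL xR (m - m') = freq xL xR m - freq xL xR m'.
Proof. by rewrite freqD freqN. Qed.

Lemma harmM A B A' B' m m' x :
  harm A B (freq xL xR m) x * harm A' B' (freq xL xR m') x =
  harm ((A * A' + B * B') / 2) ((B * A' - A * B') / 2) (freq xL xR (m - m')) x +
  harm ((A * A' - B * B') / 2) ((B * A' + A * B') / 2) (freq xL xR (m + m')) x.
Proof.
rewrite /harm freqB freqD mulrBl (mulrDl (freq xL xR m)) cosB cosD sinB sinD.
by field.
Qed.

Lemma integral_harmM A B A' B' (j k : nat) :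
  \int[mu]_(x in D) (harm A B (freq xL xR j.+1) x * harm A' B' (freq xL xR k.+1) x)
  = (j == k)%:R * (L / 2 * (A * A' + B * B')).
Proof.
under eq_Rintegral do rewrite harmM.
rewrite RintegralD; [|exact: measurable_dom|exact: integrable_harm..].
rewrite !integral_harm subr_eq0 eqz_nat eqSS [X in _ + X](_ : _ = 0).
  by rewrite addr0; congr (_ * _); field.
by rewrite -PoszD addSn /= mul0r.
Qed.

End trigonometric_integrals.

Section real_fourier_series.
Context {R : realType}.
Variables xL xR : R.
Hypothesis hx : xL < xR.
Local Notation mu := (@lebesgue_measure R).
Local Notation D := (dom xL xR).
Local Notation L := (xR - xL).
Local Notation freq := (freq xL xR).
Implicit Types (a c x : R) (u w : R -> R).
Local Open Scope complex_scope.

Definition cos_coef u (m : int) : R :=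
  L^-1 * \int[mu]_(x in D) (u x * cos (freq m * (x - xL))).

Definition sin_coef u (m : int) : R :=
  L^-1 * \int[mu]_(x in D) (u x * sin (freq m * (x - xL))).

(* The sum of the terms of indices k + 1 and - (k + 1) of the Fourier series of
   (-Delta)^a u. *)
Definition real_term a u (k : nat) x : R :=
  harm xL (2 * (`|freq k.+1| `^ (2 * a) * cos_coef u k.+1))
       (2 * (`|freq k.+1| `^ (2 * a) * sin_coef u k.+1)) (freq k.+1) x.

Lemma fourier_coef_real u m :
  fourier_coef xL xR (fun y => (u y)%:C) m = cos_coef u m +i* - sin_coef u m.
Proof.
rewrite /fourier_coef /cintegral /cos_coef /sin_coef.
rewrite [X in _ * (X +i* _)](_ : _ =
    \int[mu]_(x in D) (u x * cos (freq m * (x - xL)))); last first.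
  by apply: eq_Rintegral => x _; rewrite /= cosN mul0r subr0.
rewrite [X in _ * (_ +i* X)](_ : _ =
    - \int[mu]_(x in D) (u x * sin (freq m * (x - xL)))); last first.
  rewrite -RintegralN_total.
  by apply: eq_Rintegral => x _; rewrite /= sinN mul0r addr0 mulrN.
by apply/eqP; rewrite eq_complex /= !mul0r subr0 addr0 mulrN !eqxx.
Qed.

Lemma Re_frac_term a u x m :
  complex.Re (frac_term xL xR a (fun y => (u y)%:C) x m) =
  harm xL (`|freq m| `^ (2 * a) * cos_coef u m) (`|freq m| `^ (2 * a) * sin_coef u m)
    (freq m) x.
Proof. by rewrite /frac_term fourier_coef_real /expi /harm /=; ring. Qed.

Lemma sum_symmetric_even (F : int -> R) N : F 0 = 0 -> (forall m, F (- m) = F m) ->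
  \sum_(j < N.*2.+1) F (j%:Z - N%:Z) = \sum_(k < N) 2 * F k.+1.
Proof.
move=> F0 FN; elim: N => [|N IH].
  by rewrite double0 big_ord1 big_ord0 subrr.
rewrite doubleS big_ord_recl big_ord_recr [RHS]big_ord_recr -IH /=.
rewrite addrCA; congr (_ + _).
  by apply: eq_bigr => i _; rewrite /bump/= add1n !intS opprD addrACA subrr add0r.
rewrite sub0r FN /bump/= add1n mulr_natl mulr2n; congr (_ + F _).
by rewrite -addnn -addSn -addnS subzn ?leq_addl// addnK.
Qed.

Lemma frac_partialE a u x N : a != 0 ->
  frac_partial xL xR a (fun y => (u y)%:C) x N =
  (series (real_term a u ^~ x) N)%:C :> R[i].
Proof.
move=> a0; apply/eqP; rewrite eq_complex; apply/andP; split; last first.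
  by rewrite frac_partial_real.
apply/eqP; rewrite /frac_partial (raddf_sum (@complex.Re R)).
rewrite (sum_symmetric_even
  (F := fun m => complex.Re (frac_term xL xR a (fun y => (u y)%:C) x m))).
- rewrite seriesEord; apply: eq_bigr => k _.
  by rewrite Re_frac_term /real_term /harm; ring.
- rewrite Re_frac_term /harm /Defs.freq mulr0z mulr0 !mul0r normr0 powR0.
    by rewrite !mul0r addr0.
  by rewrite mulf_neq0.
- by move=> m; rewrite frac_termN; case: (frac_term _ _ _ _ _ _).
Qed.

Lemma is_cvg_real_term a u x : a != 0 ->
  cvgn (frac_partial xL xR a (fun y => (u y)%:C) x) ->
  cvgn (series (real_term a u ^~ x)).
Proof.
move=> a0 /cvg_ex[l /cvgrPdist_lt cl]; apply/cvg_ex; exists (complex.Re l).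
apply/cvgrPdist_lt => e e0; have e0' : (0 : R[i]) < e%:C by rewrite ltcR.
move: (cl _ e0'); apply: filterS => n; rewrite frac_partialE//.
move=> /(le_lt_trans (normc_ge_Re _)); rewrite ltcR.
by case: l {cl}.
Qed.

Lemma frac_lapE a u x l : a != 0 ->
  series (real_term a u ^~ x) @ \oo --> l -> frac_lap xL xR a u x = l.
Proof.
move=> a0 /cvgrPdist_lt cl; rewrite /frac_lap /cfrac_lap.
suff /cvg_lim -> : frac_partial xL xR a (fun y => (u y)%:C) x @ \oo -->
    (l%:C : R[i]^o).
- by [].
- exact: norm_hausdorff.
apply/cvgrPdist_lt => -[e e']; rewrite ltcE/= => /andP[/eqP -> e0].
move: (cl _ e0); apply: filterS => n; rewrite frac_partialE//.
by rewrite -rmorphB/= normc_def/= expr0n addr0 sqrtr_sqr ltcR.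
Qed.

Lemma frac_lap_cvg a u x : a != 0 ->
  cvgn (series (real_term a u ^~ x)) ->
  series (real_term a u ^~ x) @ \oo --> frac_lap xL xR a u x.
Proof. by move=> a0 /cvg_ex[l cl]; rewrite (frac_lapE a0 cl). Qed.

End real_fourier_series.

Section frac_lap_composition.
Context {R : realType}.
Variables xL xR : R.
Hypothesis hx : xL < xR.
Local Notation mu := (@lebesgue_measure R).
Local Notation D := (dom xL xR).
Local Notation L := (xR - xL).
Local Notation freq := (freq xL xR).
Implicit Types (a c x : R) (u w : R -> R).

Lemma freqS (k : nat) : freq k.+1 = freq 1 * k.+1%:R.
Proof. by rewrite /Defs.freq mulr1z -pmulrn; ring. Qed.

Lemma freq1_gt0 : 0 < freq 1.
Proof.
by rewrite /Defs.freq divr_gt0 ?subr_gt0// mulr1z mulr1 mulr_gt0// pi_gt0.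
Qed.

Lemma freqS_gt0 (k : nat) : 0 < freq k.+1.
Proof. by rewrite freqS mulr_gt0// freq1_gt0. Qed.

Lemma cvg_series_delta (k : nat) (v : R) :
  series (fun j => (j == k)%:R * v) @ \oo --> v.
Proof.
apply: cvg_near_cst; exists k.+1 => // n /= kn.
rewrite /series /= (bigD1_seq k) ?mem_index_iota ?iota_uniq//= eqxx mul1r.
by rewrite big1 ?addr0// => j /negbTE ->; rewrite mul0r.
Qed.

Section symbol.
Variables (c : R) (u : R -> R).
Hypotheses (hc : 1 < 4 * c)
  (cu : forall x, D x -> cvgn (series (real_term xL xR (2 * c) u ^~ x))).

Let l (k : nat) : R := (freq k.+1 `^ (2 * c))^-1.

Let c0 : 0 < c. Proof. by move: hc; lra. Qed.

Let l_gt0 k : 0 < l k.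
Proof. by rewrite invr_gt0 powR_gt0// freqS_gt0. Qed.

Let l_nincr : nonincreasing_seq l.
Proof.
move=> m n mn; rewrite lef_pV2 ?posrE ?powR_gt0 ?freqS_gt0//.
apply: ge0_ler_powR; rewrite ?nnegrE ?(ltW (freqS_gt0 _))//.
  by rewrite ltW// mulr_gt0.
by rewrite (freqS m) (freqS n) ler_pM2l ?freq1_gt0// ler_nat ltnS.
Qed.

Let normf k : `|freq k.+1| = freq k.+1.
Proof. by rewrite gtr0_norm ?freqS_gt0. Qed.

Let symbol_sqr k : freq k.+1 `^ (2 * (2 * c)) = (freq k.+1 `^ (2 * c)) ^+ 2.
Proof.
rewrite expr2 -powRD; last by rewrite (gt_eqF (freqS_gt0 k)) implybT.
by congr (_ `^ _); ring.
Qed.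

Let real_term_l k x :
  real_term xL xR c u k x = l k * real_term xL xR (2 * c) u k x.
Proof.
rewrite /real_term /harm !normf symbol_sqr /l.
have : freq k.+1 `^ (2 * c) != 0 by rewrite gt_eqF ?powR_gt0 ?freqS_gt0.
by set s := freq k.+1 `^ (2 * c) => s0; field.
Qed.

Let A a k := 2 * (`|freq k.+1| `^ (2 * a) * cos_coef xL xR u k.+1).
Let B a k := 2 * (`|freq k.+1| `^ (2 * a) * sin_coef xL xR u k.+1).
Let r a k := L / 2 * (A a k ^+ 2 + B a k ^+ 2).

Let ortho a j k :
  \int[mu]_(x in D) (real_term xL xR a u j x * real_term xL xR a u k x)
  = (j == k)%:R * r a k.
Proof.
rewrite /real_term integral_harmM//.
by have [->|] := eqVneq j k; rewrite ?mul0r// !mul1r.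
Qed.

Let bterm a k : bounded_measurable D (real_term xL xR a u k).
Proof. exact: bounded_measurable_harm. Qed.

Let L_gt0 : 0 < L. Proof. by rewrite subr_gt0. Qed.

Let summable_r : cvgn (series (r c)).
Proof.
have [M rM] : exists M, forall k, r (2 * c) k <= M.
  apply: (@cantor_lebesgue _ _ _ mu D (measurable_dom xL xR)
    (lebesgue_dom_lty hx) (real_term xL xR (2 * c) u) _ _ _ (2 / L)).
  - exact: bterm.
  - exact: ortho.
  - move=> k x Dx; rewrite /r mulrA.
    have -> : 2 / L * (L / 2) = 1 by field; rewrite gt_eqF.
    rewrite mul1r /real_term /harm -/(A _ _) -/(B _ _); set t := freq _ * _.
    have -> : A (2 * c) k ^+ 2 + B (2 * c) k ^+ 2 =
        (A (2 * c) k ^+ 2 + B (2 * c) k ^+ 2) * (cos t ^+ 2 + sin t ^+ 2).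
      by rewrite cos2Dsin2 mulr1.
    have := sqr_ge0 (A (2 * c) k * sin t - B (2 * c) k * cos t); nra.
  - by move=> x Dx; exact: cvg_series_cvg_0 (cu Dx).
have M0 : 0 <= M.
  by apply: le_trans (rM 0%N); rewrite mulr_ge0 ?addr_ge0 ?sqr_ge0// ltW// divr_gt0.
pose v k := (M / freq 1 `^ (4 * c)) * riemannR (4 * c) k.
have rE k : r c k = (l k) ^+ 2 * r (2 * c) k.
  rewrite /r /A /B !normf symbol_sqr /l.
  have : freq k.+1 `^ (2 * c) != 0 by rewrite gt_eqF ?powR_gt0 ?freqS_gt0.
  by set s := freq k.+1 `^ (2 * c) => s0; field.
have lE k : (l k) ^+ 2 = (freq 1 `^ (4 * c))^-1 * riemannR (4 * c) k.
  rewrite /l exprVn -symbol_sqr freqS powRM ?ler0n ?ltW ?freq1_gt0// invfM.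
  by rewrite /riemannR; congr ((_ `^ _)^-1 * (_ `^ _)^-1); ring.
apply: (@series_le_cvg _ _ v).
- by move=> k; rewrite /r mulr_ge0 ?addr_ge0 ?sqr_ge0// ltW// divr_gt0.
- move=> k; rewrite /v !mulr_ge0 ?invr_ge0 ?powR_ge0//.
- by move=> k; rewrite rE /v -mulrA -lE mulrC ler_wpM2r ?sqr_ge0.
- have -> : v = (M / freq 1 `^ (4 * c)) *: riemannR (4 * c) by apply/funext.
  by apply: is_cvg_seriesZ; exact: is_cvg_riemannR.
Qed.

Let w := frac_lap xL xR c u.

Let series_w x : D x -> series (real_term xL xR c u ^~ x) @ \oo --> w x.
Proof.
move=> Dx; apply: frac_lap_cvg; first by rewrite gt_eqF.
have -> : real_term xL xR c u ^~ x =
    (fun k => l k * real_term xL xR (2 * c) u k x).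
  by apply/funext => k; exact: real_term_l.
by apply: abel_test => //; [move=> k; exact: ltW|exact: cu].
Qed.

Let integral_w_harm A' B' (k : nat) :
  \int[mu]_(x in D) (w x * harm xL A' B' (freq k.+1) x) =
  L / 2 * (A c k * A' + B c k * B').
Proof.
have := @L2_series_termwise _ _ _ mu D (measurable_dom xL xR)
  (lebesgue_dom_lty hx) (real_term xL xR c u) (r c) w (bterm c) (ortho c)
  summable_r series_w _ (bounded_measurable_harm xL xR A' B' (freq k.+1)).
have -> : (fun j => \int[mu]_(x in D)
      (real_term xL xR c u j x * harm xL A' B' (freq k.+1) x)) =
    (fun j => (j == k)%:R * (L / 2 * (A c k * A' + B c k * B'))).
  apply/funext => j; rewrite /real_term integral_harmM//.
  by have [->|] := eqVneq j k; rewrite ?mul0r// !mul1r.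
move/(cvg_lim (@norm_hausdorff _ _)) => <-.
by apply: cvg_lim; [exact: norm_hausdorff|exact: cvg_series_delta].
Qed.

Lemma cos_coef_frac_lap k : cos_coef xL xR w k.+1 =
  `|freq k.+1| `^ (2 * c) * cos_coef xL xR u k.+1.
Proof.
rewrite {1}/cos_coef.
under eq_Rintegral => x _ do rewrite -[cos _]mul1r -[_ * cos _]addr0
  -(mul0r (sin (freq k.+1 * (x - xL)))) -/(harm _ _ _ _ _).
rewrite integral_w_harm /A; field; rewrite gt_eqF//.
Qed.

Lemma sin_coef_frac_lap k : sin_coef xL xR w k.+1 =
  `|freq k.+1| `^ (2 * c) * sin_coef xL xR u k.+1.
Proof.
rewrite {1}/sin_coef.
under eq_Rintegral => x _ do rewrite -[sin _]mul1r -[_ * sin _]add0r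
  -(mul0r (cos (freq k.+1 * (x - xL)))) -/(harm _ _ _ _ _).
rewrite integral_w_harm /B; field; rewrite gt_eqF//.
Qed.

Lemma frac_lap_composition x : D x ->
  frac_lap xL xR c (fun y => - frac_lap xL xR c u y) x =
  - frac_lap xL xR (2 * c) u x.
Proof.
move=> Dx; apply: frac_lapE; first by rewrite gt_eqF.
have -> : real_term xL xR c (fun y => - frac_lap xL xR c u y) ^~ x =
    - (real_term xL xR (2 * c) u ^~ x).
  apply/funext => k; rewrite fctE /real_term !normf symbol_sqr.
  have -> : cos_coef xL xR (fun y => - frac_lap xL xR c u y) k.+1 =
      - cos_coef xL xR w k.+1.
    rewrite /cos_coef -mulrN -RintegralN_total; congr (_ * _).
    by apply: eq_Rintegral => y _; rewrite mulNr.
  have -> : sin_coef xL xR (fun y => - frac_lap xL xR c u y) k.+1 =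
      - sin_coef xL xR w k.+1.
    rewrite /sin_coef -mulrN -RintegralN_total; congr (_ * _).
    by apply: eq_Rintegral => y _; rewrite mulNr.
  by rewrite cos_coef_frac_lap sin_coef_frac_lap !normf /harm; ring.
rewrite seriesN; apply: cvgN; apply: frac_lap_cvg; last exact: cu.
by rewrite gt_eqF// mulr_gt0.
Qed.

End symbol.
End frac_lap_composition.

Section energy_derivatives.
Context {R : realType}.
Variables (xL xR alpha beta : R) (V : R -> R).
Local Notation D := (dom xL xR).
Implicit Types (u v : R -> R).

Lemma energyE u v : energy xL xR alpha beta V u v =
  \int[@lebesgue_measure R]_(x in D) energy_density beta V x (u x) (v x)
    (frac_lap xL xR (alpha / 4) u x) (frac_lap xL xR (alpha / 4) v x).
Proof.
rewrite /energy mulNr -RintegralZl_total// -RintegralN_total.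
by apply: eq_Rintegral => x _; rewrite /energy_density mulNr.
Qed.

Lemma derive1_even_quartic (k0 k2 k4 a : R) :
  derive1 (fun b => k0 + k2 * b ^+ 2 + k4 * b ^+ 4) a = 2 * k2 * a + 4 * k4 * a ^+ 3.
Proof.
rewrite derive1E.
have -> : (fun b : R => k0 + k2 * b ^+ 2 + k4 * b ^+ 4) =
    cst k0 + k2 \*: (@id R ^+ 2) + k4 \*: (@id R ^+ 4).
  by apply/funext => b.
by rewrite derive_val /GRing.scale/=; ring.
Qed.

Lemma derive1_energy_density_value (s z wp wq x : R) :
  derive1 (fun b => energy_density beta V x b z wp wq) s
  = V x * s + beta * (s ^+ 2 + z ^+ 2) * s.
Proof.
have -> : (fun b => energy_density beta V x b z wp wq) = (fun b =>
    energy_density beta V x 0 z wp wq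
    + ((V x + beta * z ^+ 2) / 2) * b ^+ 2 + (beta / 4) * b ^+ 4).
  by apply/funext => b; rewrite /energy_density; field.
by rewrite derive1_even_quartic; field.
Qed.

Lemma derive1_energy_density_lap (s z wp wq x : R) :
  derive1 (fun b => energy_density beta V x s z b wq) wp = - wp.
Proof.
have -> : (fun b => energy_density beta V x s z b wq) = (fun b =>
    energy_density beta V x s z 0 wq + (- (1 / 2)) * b ^+ 2 + 0 * b ^+ 4).
  by apply/funext => b; rewrite /energy_density; field.
by rewrite derive1_even_quartic; field.
Qed.

Lemma energy_densityC x s z wp wq :
  energy_density beta V x s z wp wq = energy_density beta V x z s wq wp.
Proof. by rewrite /energy_density; ring. Qed.

Lemma denergy_dqE u v :
  denergy_dq xL xR alpha beta V u v = denergy_dp xL xR alpha beta V v u.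
Proof.
rewrite /denergy_dq (_ : energy_density_q xL xR alpha beta V u =
  energy_density_p xL xR alpha beta V u)//.
apply/funext => x; apply/funext => s; apply/funext => w.
exact: energy_densityC.
Qed.

Hypotheses (hx : xL < xR) (halpha : 1 < alpha).

Lemma denergy_dpE u v x : frac_lap_defined xL xR (alpha / 2) u -> D x ->
  denergy_dp xL xR alpha beta V u v x =
  V x * u x + beta * (u x ^+ 2 + v x ^+ 2) * u x - frac_lap xL xR (alpha / 2) u x.
Proof.
move=> [_ cu] Dx; have a2 : alpha / 2 = 2 * (alpha / 4) by field.
have a20 : alpha / 2 != 0 by rewrite mulf_neq0// gt_eqF// (lt_trans _ halpha).
rewrite /denergy_dp /variational_derivative /energy_density_p.
rewrite derive1_energy_density_value; congr (_ + _).
rewrite [X in frac_lap _ _ _ X](_ : _ = fun y => - frac_lap xL xR (alpha / 4) u y).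
  rewrite frac_lap_composition -?a2//; first by rewrite mulrC divfK.
  by move=> y Dy; apply: is_cvg_real_term => //; exact: cu.
by apply/funext => y; rewrite derive1_energy_density_lap.
Qed.

Lemma canonical_J_col2 (a b c d : R) :
  col2 a b = canonical_J *m col2 c d <-> a = - d /\ b = c.
Proof.
have JE : canonical_J *m col2 c d = col2 (- d) c.
  apply/matrixP => i j; rewrite !mxE big_ord_recl big_ord1 !mxE /=.
  by case: i => -[|[|//]] /= ?; rewrite ?mul0r ?mul1r ?mulN1r ?add0r ?addr0.
rewrite JE; split=> [/matrixP h|[-> ->]//].
by split; [have := h 0 0|have := h 1 0]; rewrite !mxE.
Qed.

End energy_derivatives.

Unset Implicit Arguments.

Theorem theorem2p2 (R : realType) (alpha beta xL xR T : R) (V : R -> R)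
    (p q pt qt : R -> R -> R)
    (halpha1 : 1 < alpha) (halpha2 : alpha <= 2) (hx : xL < xR) (hT : 0 < T)
    (p_periodic : forall x t, 0 < t <= T -> p (x + (xR - xL)) t = p x t)
    (q_periodic : forall x t, 0 < t <= T -> q (x + (xR - xL)) t = q x t)
    (p_defined : forall t, 0 < t <= T ->
       frac_lap_defined xL xR (alpha / 2) (p ^~ t))
    (q_defined : forall t, 0 < t <= T ->
       frac_lap_defined xL xR (alpha / 2) (q ^~ t))
    (p_diff : forall x t, dom xL xR x -> 0 < t <= T ->
       is_time_derivative T (p x) t (pt x t))
    (q_diff : forall x t, dom xL xR x -> 0 < t <= T ->
       is_time_derivative T (q x) t (qt x t)) :
  (* the densities used in the variational derivatives are those of the energy *)
  (forall u v : R -> R,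
     energy xL xR alpha beta V u v =
       density_functional xL xR alpha
         (energy_density_p xL xR alpha beta V v) u /\
     energy xL xR alpha beta V u v =
       density_functional xL xR alpha
         (energy_density_q xL xR alpha beta V u) v) /\
  ((forall x t, dom xL xR x -> 0 < t <= T ->
      pt x t = frac_lap xL xR (alpha / 2) (q ^~ t) x - V x * q x t
               - beta * (p x t ^+ 2 + q x t ^+ 2) * q x t /\
      qt x t = - frac_lap xL xR (alpha / 2) (p ^~ t) x + V x * p x t
               + beta * (p x t ^+ 2 + q x t ^+ 2) * p x t)
   <->
   (forall x t, dom xL xR x -> 0 < t <= T ->
      col2 (pt x t) (qt x t) =
      canonical_J *m
        col2 (denergy_dp xL xR alpha beta V (p ^~ t) (q ^~ t) x)
             (denergy_dq xL xR alpha beta V (p ^~ t) (q ^~ t) x))).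
Proof.
split; first by move=> u v; split; exact: energyE.
suff equiv x t : dom xL xR x -> 0 < t <= T ->
    (pt x t = frac_lap xL xR (alpha / 2) (q ^~ t) x - V x * q x t
               - beta * (p x t ^+ 2 + q x t ^+ 2) * q x t /\
     qt x t = - frac_lap xL xR (alpha / 2) (p ^~ t) x + V x * p x t
               + beta * (p x t ^+ 2 + q x t ^+ 2) * p x t) <->
    col2 (pt x t) (qt x t) = canonical_J *m
        col2 (denergy_dp xL xR alpha beta V (p ^~ t) (q ^~ t) x)
             (denergy_dq xL xR alpha beta V (p ^~ t) (q ^~ t) x).
  by split=> h x t Dx ht; apply/(equiv x t Dx ht); exact: h.
move=> Dx ht; rewrite canonical_J_col2 denergy_dqE.
rewrite (@denergy_dpE _ _ _ _ _ _ hx halpha1 _ _ _ (p_defined t ht) Dx).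
rewrite (@denergy_dpE _ _ _ _ _ _ hx halpha1 _ _ _ (q_defined t ht) Dx).
by split=> -[-> ->]; split; ring.
Qed.
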